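(* Let $X$ and $Y$ be completely regular topological spaces and let $f:X \times Y \to [-\infty, +\infty]$ be an extended real-valued function such that: (A1) for any $y \in Y$ the function $f(\cdot, y)$ is upper semicontinuous on $X$; (A2) the function $v_f$ is bounded above on $X$ and proper as a function with values in $\mathbb{R} \cup \{-\infty\}$; (A3) for any $x \in X$ the function $f(x,\cdot)$ is lower semicontinuous on $Y$; (A4) the function $w_f$ is bounded below on $Y$ and proper as a function with values in $\mathbb{R} \cup \{+\infty\}$. Let $\varepsilon'>0$, $\varepsilon''>0$, $x_0 \in X$ and $y_0 \in Y$ be such that $$v_f(x_0)>\sup_{x \in X} v_f(x) - \varepsilon', \qquad w_f(y_0)<\inf_{y \in Y} w_f(y) + \varepsilon''.$$ Let $k: X \to \mathbb{R}_{+}$ and $r: Y \to \mathbb{R}_{+}$ be continuous bounded functions such that $k(x_0)=r(y_0)=0$, $\|k\|_{\infty} < 2\varepsilon'+\varepsilon''+\Delta_f$, $\|r\|_{\infty} < \varepsilon'+2\varepsilon''+\Delta_f$, and the function $f(x,y)-k(x)+r(y)$ has a saddle point on $X\times Y$ at $(x_0,y_0)$. Suppose that $x_0$ has a countable local base in $X$ and $y_0$ has a countable local base in $Y$. Then, for arbitrary $\delta>0$, there exist continuous bounded functions $k': X \to \mathbb{R}_{+}$ and $r': Y \to \mathbb{R}_{+}$ such that $k'(x_0)=r'(y_0)=0$, $\|k'\|_{\infty} < \delta$, $\|r'\|_{\infty} < \delta$, and for the function $$g(x,y):=f(x,y)-k(x)+r(y)-k'(x)+r'(y)$$ the following hold: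 (a) the supinf problem for $g$ is sup-well-posed with unique sup-solution $x_0$; (b) the infsup problem for $g$ is inf-well-posed with unique inf-solution $y_0$; (c) the saddle point problem for $g$ is well-posed with unique solution $(x_0,y_0)$.
   Context: Completely regular spaces are assumed Hausdorff. $\mathbb{R}_+$ denotes the set of nonnegative real numbers; $\|\cdot\|_\infty$ is the supremum norm. For any $F:X \times Y \to [-\infty, +\infty]$ put $v_F(x) := \inf_{y \in Y} F(x,y)$ for $x\in X$, $w_F(y) := \sup_{x \in X} F(x,y)$ for $y\in Y$, $V_F:=\sup_{x\in X} v_F(x)$, $W_F:=\inf_{y\in Y} w_F(y)$ and $\Delta_F := W_F-V_F$ ($\Delta_f$ is finite under (A1)--(A4)). An extended real-valued function is proper if it takes a finite value at some point. A point $(x_0,y_0)\in X\times Y$ is a saddle point of $F$ on $X \times Y$ (a solution of the saddle point problem for $F$) if $F(x,y_0) \leq F(x_0,y_0) \leq F(x_0,y)$ for all $x \in X$, $y \in Y$. The supinf problem for $F$ is $\sup_{x\in X}\inf_{y\in Y}F(x,y)$; it is sup-well-posed with unique sup-solution $x_0$ if $x_0$ is the unique maximizer of $v_F$ on $X$ and every sequence $\{x_n\}_n\subset X$ with $v_F(x_n)\to V_F$ converges to $x_0$. The infsup problem for $F$ is $\inf_{y\in Y}\sup_{x\in X}F(x,y)$; it is inf-well-posed with unique inf-solution $y_0$ if $y_0$ is the unique minimizer of $w_F$ on $Y$ and every sequence $\{y_n\}_n\subset Y$ with $w_F(y_n)\to W_F$ converges to $y_0$. A sequence $\{(x_n,y_n)\}_n\subset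 X\times Y$ is optimizing for the saddle point problem for $F$ if $v_F(x_n)\to V_F$, $w_F(y_n)\to W_F$ and $\Delta_F=0$. The saddle point problem for $F$ is well-posed if it has a unique solution and every sequence optimizing for it converges to this solution. *)

(* Defs.v *)
From HB Require Import structures.
From mathcomp Require Import all_boot all_order all_algebra.
From mathcomp Require Import all_classical all_reals all_analysis.

Set Implicit Arguments.
Unset Strict Implicit.
Unset Printing Implicit Defensive.

Import Order.TTheory GRing.Theory Num.Theory.
Import numFieldNormedType.Exports.

Local Open Scope classical_set_scope.
Local Open Scope ring_scope.
Local Open Scope ereal_scope.

(* Mirror image of the library's [lower_semicontinuous]. *)
Definition upper_semicontinuous (R : realType) (X : topologicalType)
    (h : X -> \bar R) : Prop :=
  forall x (a : R), h x < a%:E ->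
    exists2 U, nbhs x U & forall y, U y -> h y < a%:E.

(* Completely regular spaces are assumed Hausdorff, which the library's
   [completely_regular_space] does not include. *)
Definition completely_regular_hausdorff (X : topologicalType) : Prop :=
  completely_regular_space X /\ hausdorff_space X.

Definition countable_local_base (X : topologicalType) (x : X) : Prop :=
  exists B : set (set X), [/\ countable B,
    (forall U, B U -> nbhs x U) &
    (forall V, nbhs x V -> exists2 U, B U & U `<=` V)].

Definition sup_norm (R : realType) (X : Type) (h : X -> R) : \bar R :=
  ereal_sup (range (fun x => `|h x|%:E)).

Definition bounded_above (R : realType) (X : Type) (h : X -> \bar R) : Prop :=
  exists M : R, forall x, h x <= M%:E.

Definition bounded_below (R : realType) (X : Type) (h : X -> \bar R) : Prop :=
  exists M : R, forall x, M%:E <= h x.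

Definition proper_fun (R : realType) (X : Type) (h : X -> \bar R) : Prop :=
  exists x, h x \is a fin_num.

Definition maximizer (R : realType) (X : Type) (h : X -> \bar R) (x0 : X) :
    Prop :=
  forall x, h x <= h x0.

Definition minimizer (R : realType) (X : Type) (h : X -> \bar R) (x0 : X) :
    Prop :=
  forall x, h x0 <= h x.

Definition v_ (R : realType) (X Y : Type) (F : X -> Y -> \bar R) (x : X) :
    \bar R :=
  ereal_inf (range (fun y => F x y)).

Definition w_ (R : realType) (X Y : Type) (F : X -> Y -> \bar R) (y : Y) :
    \bar R :=
  ereal_sup (range (fun x => F x y)).

Definition V_ (R : realType) (X Y : Type) (F : X -> Y -> \bar R) : \bar R :=
  ereal_sup (range (v_ F)).

Definition W_ (R : realType) (X Y : Type) (F : X -> Y -> \bar R) : \bar R :=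
  ereal_inf (range (w_ F)).

(* If the difference is of the form [oo - oo] it equals [-oo] in [\bar R];
   hence [Delta_ F = 0] holds exactly when [V_ F] and [W_ F] are finite and
   equal. *)
Definition Delta_ (R : realType) (X Y : Type) (F : X -> Y -> \bar R) : \bar R :=
  W_ F - V_ F.

Definition saddle_point (R : realType) (X Y : Type) (F : X -> Y -> \bar R)
    (p : X * Y) : Prop :=
  forall x y, F x p.2 <= F p.1 p.2 /\ F p.1 p.2 <= F p.1 y.

Definition sup_well_posed (R : realType) (X : topologicalType) (Y : Type)
    (F : X -> Y -> \bar R) (x0 : X) : Prop :=
  unique (maximizer (v_ F)) x0 /\
  forall x_ : nat -> X,
    v_ F (x_ n) @[n --> \oo] --> V_ F -> x_ n @[n --> \oo] --> x0.

Definition inf_well_posed (R : realType) (X : Type) (Y : topologicalType)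
    (F : X -> Y -> \bar R) (y0 : Y) : Prop :=
  unique (minimizer (w_ F)) y0 /\
  forall y_ : nat -> Y,
    w_ F (y_ n) @[n --> \oo] --> W_ F -> y_ n @[n --> \oo] --> y0.

Definition optimizing (R : realType) (X Y : Type) (F : X -> Y -> \bar R)
    (p_ : nat -> X * Y) : Prop :=
  [/\ v_ F (p_ n).1 @[n --> \oo] --> V_ F,
      w_ F (p_ n).2 @[n --> \oo] --> W_ F &
      Delta_ F = 0].

Definition saddle_well_posed (R : realType) (X Y : topologicalType)
    (F : X -> Y -> \bar R) (p : X * Y) : Prop :=
  unique (saddle_point F) p /\
  forall p_ : nat -> X * Y, optimizing F p_ -> p_ n @[n --> \oo] --> p.

(* Main.v *)
Require Import Defs.
From HB Require Import structures.
From mathcomp Require Import all_boot all_order all_algebra.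
From mathcomp Require Import all_classical all_reals all_analysis.
From mathcomp Require Import lra.

Set Implicit Arguments.
Unset Strict Implicit.
Unset Printing Implicit Defensive.

Import Order.TTheory GRing.Theory Num.Theory.
Import numFieldNormedType.Exports.

Local Open Scope classical_set_scope.
Local Open Scope ring_scope.

(** Everything rests on two inequalities.  Let [h = f - k + r], with saddle point
    [(x0, y0)] and value [c = h x0 y0 = f x0 y0], which is finite because
    [V_ f - e1 < v_ f x0 <= f x0 y0 <= w_ f y0 < W_ f + e2].  Let
    [g = h - k' + r'], where [k'] and [r'] are nonnegative and vanish at [x0]
    and [y0].  Testing [v_ g x] at [y0] and [w_ g y] at [x0] gives
    [v_ g x <= c - k' x] and [c + r' y <= w_ g y], while [(x0, y0)] is still a
    saddle point of [g] with value [c], so that [V_ g = W_ g = c].  Hence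
    [v_ g (x_ n) --> V_ g] forces [k' (x_ n) --> 0], and [w_ g (y_ n) --> W_ g]
    forces [r' (y_ n) --> 0]; at any other saddle point [(x, y)] one has
    [c + r' y <= w_ g y = v_ g x <= c - k' x], so [k'] and [r'] vanish there.

    It remains to choose [k'] and [r'] small, continuous, and such that small
    values are only taken near [x0], resp. [y0] ([strong_zero] below).  This is
    where the countable local bases are used: if [u n] is a continuous function
    with values in [0, 1] that vanishes at [x0] and equals [1] off the [n]-th
    basic neighbourhood, then [\sum_n c / 2 ^ (n + 1) * u n] has this property
    ([exists_strong_zero]). *)

(** * Functions that are small only near a given point *)

(** A nonnegative [k] is a strong zero at [x0] when [x0] is a well-posed minimum
    of [k]; the formulation with neighbourhoods avoids sequences. *)
Definition strong_zero (R : realType) (X : topologicalType) (k : X -> R)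
    (x0 : X) : Prop :=
  [/\ forall x, 0 <= k x, k x0 = 0 &
      forall V, nbhs x0 V -> exists2 eta, 0 < eta & forall x, k x < eta -> V x].

Lemma strong_zero_unique (R : realType) (X : topologicalType) (k : X -> R)
    (x0 x : X) :
  hausdorff_space X -> strong_zero k x0 -> k x <= 0 -> x = x0.
Proof.
move=> hX [_ _ kV] kx.
apply/esym/hX => A B /kV[eta eta0 Aeta] /nbhs_singleton Bx.
by exists x; split=> //; apply: Aeta; apply: le_lt_trans kx eta0.
Qed.

Lemma countable_local_base_seq (X : topologicalType) (x0 : X) :
  countable_local_base x0 ->
  exists U : nat -> set X, (forall n, nbhs x0 (U n)) /\
    forall V, nbhs x0 V -> exists n, U n `<=` V.
Proof.
move=> [B [/countable_injP[i iinj] Bx0 Bbase]].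
(* Numbers that are not the code of a basic set are sent to the whole space. *)
exists (fun n => [set x | forall b, B b -> i b = n -> b x]); split=> [n|V /Bbase].
  have [[b [Bb <-]]|nob] := pselect (exists b, B b /\ i b = n).
    apply: filterS (Bx0 _ Bb) => x bx b' Bb' ib'.
    by rewrite (iinj b' b) ?inE.
  by apply: filterS filterT => x _ b Bb ib; case: nob; exists b.
by move=> [b Bb bV]; exists (i b) => x /(_ b Bb erefl) /bV.
Qed.

Section DyadicSum.
Variables (R : realType) (X : topologicalType) (c : R) (u : nat -> X -> R).
Hypotheses (c_ge0 : 0 <= c) (u_ge0 : forall n x, 0 <= u n x)
  (u_le1 : forall n x, u n x <= 1) (u_cont : forall n, continuous (u n)).

Let S n x : R := \sum_(i < n) c / 2 ^+ i.+1 * u i x.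

(** The supremum of the partial sums is the sum of the series, since its terms
    are nonnegative. *)
Definition dyadic_sum (x : X) : R := sup (range (S ^~ x)).

Let weight_ge0 n : 0 <= c / 2 ^+ n.
Proof. by rewrite divr_ge0 // exprn_ge0. Qed.

Let S_le n m x : (n <= m)%N -> S n x <= S m x.
Proof.
move=> /subnKC <-; elim: (m - n)%N => [|d IHd]; first by rewrite addn0.
by rewrite addnS /S big_ord_recr /= (le_trans IHd)// lerDl mulr_ge0.
Qed.

(** The last weight added bounds the sum of all the weights still to come. *)
Let S_tail n m x : (n <= m)%N -> S m x + c / 2 ^+ m <= S n x + c / 2 ^+ n.
Proof.
move=> /subnKC <-; elim: (m - n)%N => [|d IHd]; first by rewrite addn0.
apply: le_trans IHd; rewrite addnS /S big_ord_recr /= -addrA lerD2l.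
have -> : c / 2 ^+ (n + d) = c / 2 ^+ (n + d).+1 + c / 2 ^+ (n + d).+1.
  by rewrite exprS invfM mulrCA -mulrDl; lra.
by rewrite lerD2r ler_piMr.
Qed.

Let S_ub n m x : S m x <= S n x + c / 2 ^+ n.
Proof.
have [nm|/ltnW mn] := leqP n m.
  by apply: le_trans (S_tail x nm); rewrite lerDl.
by rewrite (le_trans (S_le x mn))// lerDl.
Qed.

Lemma dyadic_sum_tail n x :
  S n x <= dyadic_sum x <= S n x + c / 2 ^+ n.
Proof.
apply/andP; split.
  apply: ub_le_sup; last by exists n.
  by exists (S 0 x + c / 2 ^+ 0) => _ [m _ <-]; exact: S_ub.
by apply: ge_sup => [|_ [m _ <-]]; [exists (S n x), n | exact: S_ub].
Qed.

Lemma dyadic_sum_ge0 x : 0 <= dyadic_sum x.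
Proof. by have /andP[+ _] := dyadic_sum_tail 0 x; rewrite /S big_ord0. Qed.

Lemma dyadic_sum_le x : dyadic_sum x <= c.
Proof.
by have /andP[_] := dyadic_sum_tail 0 x; rewrite /S big_ord0 add0r expr0 divr1.
Qed.

Lemma dyadic_sum_ge_term n x : c / 2 ^+ n.+1 * u n x <= dyadic_sum x.
Proof.
have /andP[+ _] := dyadic_sum_tail n.+1 x; apply: le_trans.
by rewrite /S big_ord_recr /= lerDr sumr_ge0// => i _; rewrite mulr_ge0.
Qed.

Lemma dyadic_sum_eq0 x : (forall n, u n x = 0) -> dyadic_sum x = 0.
Proof.
move=> ux0; apply/eqP; rewrite eq_le dyadic_sum_ge0 andbT.
apply: ge_sup => [|_ [n _ <-]]; first by exists (S 0 x), 0%N.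
by rewrite /S big1// => i _; rewrite ux0 mulr0.
Qed.

(** A uniform limit of the continuous partial sums. *)
Lemma dyadic_sum_continuous : continuous dyadic_sum.
Proof.
have S_cont n : continuous (S n).
  apply: continuous_big => [|i _ x]; first exact: add_continuous.
  by apply: cvgM; [exact: cvg_cst | exact: u_cont].
have small e : 0 < e -> exists n, c / 2 ^+ n < e.
  move=> e0.
  have /cvgrPdist_lt/(_ e e0) : geometric c 2^-1 n @[n --> \oo] --> (0 : R).
    by apply: cvg_geometric; rewrite ger0_norm; lra.
  move=> [n _ /(_ n (leqnn n))]; rewrite /= sub0r normrN exprVn.
  by rewrite ger0_norm//; exists n.
move=> x; apply/cvgrPdist_lt => e e0.
have [n cn] : exists n, c / 2 ^+ n < e / 2 by apply: small; lra.
have e20 : 0 < e / 2 by lra.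
have := S_cont n x; move/cvgrPdist_lt => /(_ _ e20); apply: filterS => y.
have /andP[] := dyadic_sum_tail n x; have /andP[] := dyadic_sum_tail n y.
rewrite !ltr_norml => *; apply/andP; lra.
Qed.

End DyadicSum.

Lemma exists_strong_zero (R : realType) (X : topologicalType) (x0 : X) (c : R) :
  completely_regular_space X -> countable_local_base x0 -> 0 < c ->
  exists k : X -> R,
    [/\ strong_zero k x0, continuous k & forall x, k x <= c].
Proof.
move=> crX /countable_local_base_seq[U [Ux0 Ubase]] c0.
have sep n : exists u : X -> R, [/\ continuous u, forall x, 0 <= u x <= 1,
    u x0 = 0 & forall x, ~ U n x -> u x = 1].
  have : uniform_separator [set x0] (~` (U n)°).
    apply: crX; first exact: open_closedC (@open_interior _ _).
    by apply; exact: Ux0.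
  move=> /(uniform_separatorP (R := R))[u [uc u01 u0 u1]]; exists u; split=> //.
  - by move=> x; have := u01 (u x) (ex_intro2 _ _ x I erefl); rewrite /= in_itv.
  - by apply: u0; exists x0.
  - by move=> x Ux; apply: u1; exists x => // /interior_subset.
have [u uP] := choice sep.
have u_ge0 n x : 0 <= u n x by have [_ /(_ x)/andP[]] := uP n.
have u_le1 n x : u n x <= 1 by have [_ /(_ x)/andP[]] := uP n.
have u_cont n : continuous (u n) by have [] := uP n.
exists (dyadic_sum c u); split.
- split; [|apply: dyadic_sum_eq0|] => //.
  + by move=> x; apply: dyadic_sum_ge0 => //; exact: ltW.
  + exact: ltW.
  + by move=> n; have [] := uP n.
  move=> V /Ubase[n UV]; exists (c / 2 ^+ n.+1).
    by rewrite divr_gt0 // exprn_gt0.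
  move=> x kx; apply: UV; apply: contrapT => nUx.
  have [_ _ _ /(_ x nUx) ux] := uP n.
  have := dyadic_sum_ge_term (ltW c0) u_ge0 u_le1 n x.
  by rewrite ux mulr1 leNgt kx.
- by apply: dyadic_sum_continuous => //; exact: ltW.
- by move=> x; apply: dyadic_sum_le => //; exact: ltW.
Qed.

Lemma sup_norm_lt (R : realType) (X : Type) (k : X -> R) (c d : R) :
  (forall x, 0 <= k x <= c) -> c < d -> (sup_norm k < d%:E)%E.
Proof.
move=> kc cd; apply: (@le_lt_trans _ _ c%:E); last by rewrite lte_fin.
apply: ge_ereal_sup => _ [x _ <-]; have /andP[k0 kxc] := kc x.
by rewrite lee_fin ger0_norm.
Qed.

Lemma ge0_le_bounded_fun (R : realType) (X : Type) (k : X -> R) (c : R) :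
  (forall x, 0 <= k x <= c) -> bounded_fun k.
Proof.
move=> kc; exists c; split; first exact: num_real.
move=> M cM x _; have /andP[k0 kxc] := kc x.
by rewrite /= ger0_norm// (le_trans kxc (ltW cM)).
Qed.

(** * Saddle points and well-posedness *)

Lemma saddle_point_values (R : realType) (X Y : Type) (F : X -> Y -> \bar R)
    (x0 : X) (y0 : Y) : saddle_point F (x0, y0) ->
  [/\ v_ F x0 = F x0 y0, w_ F y0 = F x0 y0, V_ F = F x0 y0 & W_ F = F x0 y0].
Proof.
move=> sF; have vE : v_ F x0 = F x0 y0.
  apply/eqP; rewrite eq_le; apply/andP; split.
    by apply: ereal_inf_lbound; exists y0.
  by apply: le_ereal_inf_tmp => _ [y _ <-]; have [] := sF x0 y.
have wE : w_ F y0 = F x0 y0.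
  apply/eqP; rewrite eq_le; apply/andP; split; last first.
    by apply: ereal_sup_ubound; exists x0.
  by apply: ge_ereal_sup => _ [x _ <-]; have [] := sF x y0.
split=> //; apply/eqP; rewrite eq_le; apply/andP; split.
- apply: ge_ereal_sup => _ [x _ <-]; apply: (@le_trans _ _ (F x y0)).
    by apply: ereal_inf_lbound; exists y0.
  by have [] := sF x y0.
- by apply: ereal_sup_ubound; exists x0.
- by apply: ereal_inf_lbound; exists y0.
- apply: le_ereal_inf_tmp => _ [y _ <-]; apply: (@le_trans _ _ (F x0 y)).
    by have [] := sF x0 y.
  by apply: ereal_sup_ubound; exists x0.
Qed.

(** Both halves of the argument, for [v_ g] below [c] and for [w_ g] above [c],
    are covered by measuring the distance to [c]. *)
Lemma strong_zero_cvg (R : realType) (X : topologicalType) (k : X -> R) (x0 : X)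
    (phi : X -> \bar R) (c : R) (x_ : nat -> X) :
  strong_zero k x0 -> (forall x, ((k x)%:E <= `|phi x - c%:E|)%E) ->
  phi (x_ n) @[n --> \oo] --> c%:E -> x_ n @[n --> \oo] --> x0.
Proof.
move=> [_ _ kV] kphi /fine_cvgP[phifin phic] V /kV[eta eta0 etaV].
move/cvgrPdist_lt : phic => /(_ eta eta0) phic.
apply: filterS2 phifin phic => n nfin; rewrite distrC => dist.
apply: etaV; rewrite -lte_fin; apply: (le_lt_trans (kphi _)).
by rewrite -(fineK nfin) -EFinB abse_EFin lte_fin.
Qed.

Section Perturbation.
Variables (R : realType) (X Y : topologicalType) (h : X -> Y -> \bar R).
Variables (x0 : X) (y0 : Y) (c : R) (k : X -> R) (r : Y -> R).
Hypotheses (hX : hausdorff_space X) (hY : hausdorff_space Y).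
Hypotheses (h_saddle : saddle_point h (x0, y0)) (h_val : h x0 y0 = c%:E).
Hypotheses (k_zero : strong_zero k x0) (r_zero : strong_zero r y0).

Let g x y := (h x y - (k x)%:E + (r y)%:E)%E.

Let k_ge0 x : 0 <= k x. Proof. by case: k_zero. Qed.
Let r_ge0 y : 0 <= r y. Proof. by case: r_zero. Qed.
Let kx0 : k x0 = 0. Proof. by case: k_zero. Qed.
Let ry0 : r y0 = 0. Proof. by case: r_zero. Qed.

Let g_le x : (g x y0 <= (c - k x)%:E)%E.
Proof.
rewrite /g ry0 adde0 EFinB leeD2r// -h_val.
by have [] := h_saddle x y0.
Qed.

Let g_ge y : ((c + r y)%:E <= g x0 y)%E.
Proof.
rewrite /g kx0 sube0 EFinD leeD2r// -h_val.
by have [] := h_saddle x0 y.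
Qed.

Let g_val : g x0 y0 = c%:E.
Proof. by rewrite /g kx0 ry0 sube0 adde0. Qed.

Let g_saddle : saddle_point g (x0, y0).
Proof.
move=> x y /=; rewrite g_val; split.
  by apply: (le_trans (g_le x)); rewrite lee_fin gerBl.
by apply: le_trans (g_ge y); rewrite lee_fin lerDl.
Qed.

Let v_le x : (v_ g x <= (c - k x)%:E)%E.
Proof. by apply: le_trans (g_le x); apply: ereal_inf_lbound; exists y0. Qed.

Let w_ge y : ((c + r y)%:E <= w_ g y)%E.
Proof. by apply: (le_trans (g_ge y)); apply: ereal_sup_ubound; exists x0. Qed.

Let sup_conv (x_ : nat -> X) :
  v_ g (x_ n) @[n --> \oo] --> V_ g -> x_ n @[n --> \oo] --> x0.
Proof.
have [_ _ -> _] := saddle_point_values g_saddle; rewrite g_val.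
apply: strong_zero_cvg k_zero _ => x.
have := v_le x; case: (v_ g x) => [s| |]; rewrite ?leey//= !lee_fin => sc.
by rewrite distrC ger0_norm; [lra | have := k_ge0 x; lra].
Qed.

Let inf_conv (y_ : nat -> Y) :
  w_ g (y_ n) @[n --> \oo] --> W_ g -> y_ n @[n --> \oo] --> y0.
Proof.
have [_ _ _ ->] := saddle_point_values g_saddle; rewrite g_val.
apply: strong_zero_cvg r_zero _ => y.
have := w_ge y; case: (w_ g y) => [s| |]; rewrite ?leey//= !lee_fin => sc.
by rewrite ger0_norm; [lra | have := r_ge0 y; lra].
Qed.

Lemma perturbed_sup_well_posed : sup_well_posed g x0.
Proof.
have [vE _ _ _] := saddle_point_values g_saddle.
split=> //; split=> [x|x xmax].
  by rewrite vE g_val (le_trans (v_le x))// lee_fin gerBl.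
apply/esym/(strong_zero_unique hX k_zero).
have := le_trans (xmax x0) (v_le x); rewrite vE g_val lee_fin; lra.
Qed.

Lemma perturbed_inf_well_posed : inf_well_posed g y0.
Proof.
have [_ wE _ _] := saddle_point_values g_saddle.
split=> //; split=> [y|y ymin].
  by rewrite wE g_val; apply: le_trans (w_ge y); rewrite lee_fin lerDl.
apply/esym/(strong_zero_unique hY r_zero).
have := le_trans (w_ge y) (ymin y0); rewrite wE g_val lee_fin; lra.
Qed.

Lemma perturbed_saddle_well_posed : saddle_well_posed g (x0, y0).
Proof.
split; [split=> // -[x y] sxy|move=> p_ [pv pw _]].
  have [vE wE _ _] := saddle_point_values sxy.
  have := w_ge y; rewrite wE -vE => /le_trans/(_ (v_le x)).
  rewrite lee_fin => rk; have := k_ge0 x; have := r_ge0 y => *.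
  by congr pair; apply/esym; [apply: (strong_zero_unique hX k_zero)|
    apply: (strong_zero_unique hY r_zero)]; lra.
have -> : p_ = fun n => ((p_ n).1, (p_ n).2).
  by apply/funext => n; exact: surjective_pairing.
exact: cvg_pair (sup_conv pv) (inf_conv pw).
Qed.

End Perturbation.

Theorem theorem4p3 (R : realType) (X Y : topologicalType)
  (crX : completely_regular_hausdorff X) (crY : completely_regular_hausdorff Y)
  (f : X -> Y -> \bar R)
  (A1 : forall y, upper_semicontinuous (fun x => f x y))
  (A2 : bounded_above (v_ f) /\ proper_fun (v_ f))
  (A3 : forall x, lower_semicontinuous (fun y => f x y))
  (A4 : bounded_below (w_ f) /\ proper_fun (w_ f))
  (e1 e2 : R) (e1_gt0 : 0 < e1) (e2_gt0 : 0 < e2)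
  (x0 : X) (y0 : Y)
  (vx0 : (V_ f - e1%:E < v_ f x0)%E)
  (wy0 : (w_ f y0 < W_ f + e2%:E)%E)
  (k : X -> R) (r : Y -> R)
  (k_ge0 : forall x, 0 <= k x) (r_ge0 : forall y, 0 <= r y)
  (k_cont : continuous k) (r_cont : continuous r)
  (k_bnd : bounded_fun k) (r_bnd : bounded_fun r)
  (kx0 : k x0 = 0) (ry0 : r y0 = 0)
  (k_norm : (sup_norm k < (2 * e1 + e2)%:E + Delta_ f)%E)
  (r_norm : (sup_norm r < (e1 + 2 * e2)%:E + Delta_ f)%E)
  (saddle : saddle_point (fun x y => f x y - (k x)%:E + (r y)%:E)%E (x0, y0))
  (baseX : countable_local_base x0) (baseY : countable_local_base y0)
  (delta : R) (delta_gt0 : 0 < delta) :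
  exists (k' : X -> R) (r' : Y -> R),
    [/\ (forall x, 0 <= k' x) /\ (forall y, 0 <= r' y),
        continuous k' /\ continuous r',
        bounded_fun k' /\ bounded_fun r',
        k' x0 = 0 /\ r' y0 = 0 &
        (sup_norm k' < delta%:E)%E /\ (sup_norm r' < delta%:E)%E] /\
    let g := (fun x y =>
      f x y - (k x)%:E + (r y)%:E - (k' x)%:E + (r' y)%:E)%E in
    [/\ sup_well_posed g x0,
        inf_well_posed g y0 &
        saddle_well_posed g (x0, y0)].
Proof.
have /andP[d2_gt0 d2_lt] : (0 < delta / 2) && (delta / 2 < delta) by apply/andP; lra.
have [k' [k'_zero k'_cont k'_le]] := exists_strong_zero crX.1 baseX d2_gt0.
have [r' [r'_zero r'_cont r'_le]] := exists_strong_zero crY.1 baseY d2_gt0.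
have [k'_ge0 k'x0 _] := k'_zero; have [r'_ge0 r'y0 _] := r'_zero.
have k'_bnd x : 0 <= k' x <= delta / 2 by rewrite k'_ge0 k'_le.
have r'_bnd y : 0 <= r' y <= delta / 2 by rewrite r'_ge0 r'_le.
exists k', r'; split.
  split=> //; first by split; exact: ge0_le_bounded_fun.
  by split; exact: sup_norm_lt.
have v_le : (v_ f x0 <= f x0 y0)%E by apply: ereal_inf_lbound; exists y0.
have w_ge : (f x0 y0 <= w_ f y0)%E by apply: ereal_sup_ubound; exists x0.
have f_fin : f x0 y0 \is a fin_num.
  rewrite fin_real// (le_lt_trans (leNye _) (lt_le_trans vx0 v_le)) /=.
  exact: le_lt_trans w_ge (lt_le_trans wy0 (leey _)).
have h_val : (f x0 y0 - (k x0)%:E + (r y0)%:E)%E = (fine (f x0 y0))%:E.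
  by rewrite kx0 ry0 sube0 adde0 fineK.
split.
- exact: perturbed_sup_well_posed crX.2 saddle h_val k'_zero r'_zero.
- exact: perturbed_inf_well_posed crY.2 saddle h_val k'_zero r'_zero.
- exact: perturbed_saddle_well_posed crX.2 crY.2 saddle h_val k'_zero r'_zero.
Qed.
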